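(* There exists a family $\mathcal F_1$ of $5$ axis-parallel rectangles such that $\pi_L(\mathcal F_1)\ge \frac{6}{5}\,\pi(\mathcal F_1)$.
   Context: For a finite family $\mathcal F$ of closed axis-parallel rectangles in the plane, a point set $P\subset\mathbb R^2$ is $\mathcal F$-piercing if every translate of every rectangle in $\mathcal F$ contains a point of $P$. The density of a point set $P$ is $\limsup_{r\to\infty} |P\cap[-r,r]^2|/(2r)^2$. $\pi(\mathcal F)$ is the infimum of the densities of $\mathcal F$-piercing point sets, and $\pi_L(\mathcal F)$ is the infimum of the densities of $\mathcal F$-piercing lattices, where a lattice $\{iu+jv:i,j\in\mathbb Z\}$ ($u,v$ linearly independent) has density $1/|\det[u,v]|$. *)

(* Defs.v *)
From mathcomp Require Import all_boot all_order all_algebra.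
From mathcomp Require Import all_classical all_reals all_analysis.
Set Implicit Arguments. Unset Strict Implicit. Unset Printing Implicit Defensive.
Import Order.TTheory GRing.Theory Num.Theory numFieldNormedType.Exports.
Local Open Scope classical_set_scope.
Local Open Scope ring_scope.

Section Piercing.
Variable R : realType.

(* A closed axis-parallel rectangle [a,b] x [c,d], encoded as ((a,b),c),d. *)
Definition rect (q : R * R * R * R) : set (R * R) :=
  [set p | q.1.1.1 <= p.1 <= q.1.1.2 /\ q.1.2 <= p.2 <= q.2].

Definition proper_rect (q : R * R * R * R) : Prop :=
  q.1.1.1 < q.1.1.2 /\ q.1.2 < q.2.

Definition translate (t : R * R) (A : set (R * R)) : set (R * R) :=
  [set p | A (p.1 - t.1, p.2 - t.2)].

Definition piercing (F : seq (R * R * R * R)) (P : set (R * R)) : Prop :=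
  forall q, q \in F -> forall t : R * R, exists p, P p /\ translate t (rect q) p.

Definition box (r : R) : set (R * R) := [set p | `|p.1| <= r /\ `|p.2| <= r].

(* |P /\ [-r,r]^2| as an extended real (+oo if infinite) *)
Definition count_in (P : set (R * R)) (r : R) : \bar R :=
  \esum_(p in P `&` box r) 1%E.

Definition density (P : set (R * R)) : \bar R :=
  limf_esup (fun r : R => (count_in P r * ((2 * r) ^+ 2)^-1%:E)%E) +oo.

Definition pi_dens (F : seq (R * R * R * R)) : \bar R :=
  ereal_inf [set density P | P in [set P | piercing F P]].

Definition lattice (u v : R * R) : set (R * R) :=
  [set p | exists i j : int, p = (i%:~R * u.1 + j%:~R * v.1, i%:~R * u.2 + j%:~R * v.2)].

Definition det2 (u v : R * R) : R := u.1 * v.2 - u.2 * v.1.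

Definition pi_lat (F : seq (R * R * R * R)) : \bar R :=
  ereal_inf [set (`|det2 uv.1 uv.2|^-1)%:E | uv in
    [set uv : (R * R) * (R * R) | det2 uv.1 uv.2 != 0 /\ piercing F (lattice uv.1 uv.2)]].

End Piercing.

(* Main.v *)
(** The family consists of the rectangles 6x1, 4x2, 3x3, 2x4 and 1x6. A
    6-periodic set with six points per period, one in each row and column of
    the 6x6 torus, meets every w x h block of Z^2 for each w x h in the family,
    so the piercing density is at most 1/6.

    Conversely, let [c, d, e, f >= 0] and let a piercing lattice be generated by
    [(c, - d)] and [(e, d + f)]; its determinant is [c * d + c * f + e * d]. The
    open rectangle with [0] and [(c + e, f)] on its vertical sides and
    [(c, - d)] and [(e, d + f)] on its horizontal sides contains no lattice
    point, so each w x h in the family has [c + e <= w] or [d + d + f <= h].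
    Replacing a generator by the sum of both gives, up to reflection, the next
    basis of this kind, with a wider and lower empty rectangle, and transposing
    the plane reverses the order of this chain. Where the width passes 3, the
    constraints from the nearest members of the chain force the determinant to
    be at most 5. *)

Require Import Defs.
From mathcomp Require Import all_boot all_order all_algebra.
From mathcomp Require Import all_classical all_reals all_analysis.
From mathcomp Require Import finmap ring lra zify.
Import Order.TTheory GRing.Theory Num.Theory numFieldNormedType.Exports.
Local Open Scope classical_set_scope.
Local Open Scope ring_scope.

Set Implicit Arguments.
Unset Strict Implicit.
Unset Printing Implicit Defensive.

Definition block {R : realType} (wh : R * R) : R * R * R * R :=
  (0, wh.1, 0, wh.2).

Section Blocks.
Variable R : realType.
Implicit Types (P : set (R * R)) (s : seq (R * R)) (w h : R).

Definition meets_blocks P w h : Prop :=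
  forall x y, exists p, [/\ P p, x <= p.1 <= x + w & y <= p.2 <= y + h].

Lemma piercing_blocksP s P : piercing (map block s) P <->
  forall w h, (w, h) \in s -> meets_blocks P w h.
Proof.
split=> [pP w h wh_s x y|meetsP _ /mapP[[w h] wh_s ->] [x y]].
- have [p [Pp [/= p1 p2]]] := pP _ (map_f block wh_s) (x, y).
  by exists p; split=> //; lra.
- have [p [Pp p1 p2]] := meetsP w h wh_s x y.
  by exists p; split=> //; rewrite /translate /rect /=; lra.
Qed.

End Blocks.

Section LatticeBases.
Variable R : realType.
Implicit Types (u v p : R * R) (s : seq (R * R)) (a b c d w h : R).

Lemma lattice_subset u v u' v' :
  lattice u v u' -> lattice u v v' -> lattice u' v' `<=` lattice u v.
Proof.
move=> [i [j ->]] [k [l ->]] _ [m [n ->]] /=.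
exists (m * i + n * k), (m * j + n * l).
by rewrite !intrD !intrM; congr pair; ring.
Qed.

Lemma lattice_eq u v u' v' : lattice u v u' -> lattice u v v' ->
  lattice u' v' u -> lattice u' v' v -> lattice u' v' = lattice u v.
Proof. by move=> *; apply/seteqP; split; apply: lattice_subset. Qed.

Lemma lattice_swap u v : lattice v u = lattice u v.
Proof.
by apply: lattice_eq; [exists 0, 1|exists 1, 0|exists 0, 1|exists 1, 0];
  rewrite [LHS]surjective_pairing; congr pair; ring.
Qed.

Lemma lattice_opp u v : lattice (- u) v = lattice u v.
Proof.
by apply: lattice_eq; [exists (-1), 0|exists 0, 1|exists (-1), 0|exists 0, 1];
  rewrite [LHS]surjective_pairing; congr pair => /=; ring.
Qed.

Lemma lattice_sub a b c d :
  lattice (a - c, b - d) (c, d) = lattice (a, b) (c, d).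
Proof.
by apply: lattice_eq; [exists 1, (-1)|exists 0, 1|exists 1, 1|exists 0, 1];
  congr pair => /=; ring.
Qed.

Lemma lattice_reflect u v p : lattice u v p ->
  lattice (u.1, - u.2) (v.1, - v.2) (p.1, - p.2).
Proof. by move=> [i [j ->]]; exists i, j; congr pair => /=; ring. Qed.

Lemma lattice_transpose u v p : lattice u v p ->
  lattice (u.2, u.1) (v.2, v.1) (p.2, p.1).
Proof. by move=> [i [j ->]]; exists i, j. Qed.

Lemma piercing_reflect s u v : piercing (map block s) (lattice u v) ->
  piercing (map block s) (lattice (u.1, - u.2) (v.1, - v.2)).
Proof.
move=> /piercing_blocksP meetsL; apply/piercing_blocksP => w h wh_s x y.
have [p [Lp p1 p2]] := meetsL w h wh_s x (- y - h).
by exists (p.1, - p.2); split=> //=; [exact: lattice_reflect|lra].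
Qed.

Lemma piercing_transpose s u v : (forall w h, (w, h) \in s -> (h, w) \in s) ->
  piercing (map block s) (lattice u v) ->
  piercing (map block s) (lattice (u.2, u.1) (v.2, v.1)).
Proof.
move=> s_sym /piercing_blocksP meetsL; apply/piercing_blocksP => w h wh_s x y.
have [p [Lp p1 p2]] := meetsL h w (s_sym w h wh_s) y x.
by exists (p.2, p.1); split=> //; exact: lattice_transpose.
Qed.

Lemma lattice_empty_rectangle a b c d p :
  0 <= a -> 0 <= b -> 0 <= c -> 0 <= d -> lattice (a, b) (c, - d) p ->
  ~ (0 < p.1 < a + c /\ - d < p.2 < b).
Proof.
move=> a0 b0 c0 d0 [i [j ->]] /= [p1 p2].
have le0_or_ge1 (m : int) : m%:~R <= 0 :> R \/ 1 <= m%:~R :> R.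
  have [m0|m0] := leP m 0; first by left; rewrite lerz0.
  by right; rewrite ler1z -gtz0_ge1.
have [i0|i1] := le0_or_ge1 i; have [j0|j1] := le0_or_ge1 j.
- suff : i%:~R * a + j%:~R * c <= 0 by lra.
  nra.
- suff : i%:~R * b + j%:~R * - d <= - d by lra.
  nra.
- suff : b <= i%:~R * b + j%:~R * - d by lra.
  nra.
- suff : a + c <= i%:~R * a + j%:~R * c by lra.
  nra.
Qed.

Lemma piercing_fits s a b c d w h :
  0 <= a -> 0 <= b -> 0 <= c -> 0 <= d ->
  piercing (map block s) (lattice (a, b) (c, - d)) -> (w, h) \in s ->
  a + c <= w \/ b + d <= h.
Proof.
move=> a0 b0 c0 d0 /piercing_blocksP meetsL wh_s.
have [|w_lt] := leP (a + c) w; first by left.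
have [|h_lt] := leP (b + d) h; first by right.
have [p [Lp p1 p2]] := meetsL w h wh_s ((a + c - w) / 2) ((b - d - h) / 2).
by case: (lattice_empty_rectangle a0 b0 c0 d0 Lp); lra.
Qed.

End LatticeBases.

Section Superbases.
Variables (R : realType) (s : seq (R * R)).
Implicit Types (u v : R * R) (a b c d e f w h D M : R).

(* The third vector of the superbase is the sum [(c + e, f)]; up to signs, the
   transposition of the plane exchanges it with [(e, d + f)]. *)
Definition piercing_superbase c d e f : Prop :=
  [/\ 0 <= c, 0 <= d, 0 <= e & 0 <= f] /\
  piercing (map block s) (lattice (c, - d) (e, d + f)).

Definition superbase_det c d e f : R := c * d + c * f + e * d.

Lemma superbase_det_transpose c d e f :
  superbase_det d c f e = superbase_det c d e f.
Proof. by rewrite /superbase_det; ring. Qed.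

Lemma superbase_det_next_le c d e f :
  superbase_det c d (c + e) (f - d) = superbase_det c d e f.
Proof. by rewrite /superbase_det; ring. Qed.

Lemma superbase_det_next_ge c d e f :
  superbase_det (c + e) f c (d - f) = superbase_det c d e f.
Proof. by rewrite /superbase_det; ring. Qed.

Lemma superbase_of_mixed_basis D a b c d :
  0 <= a -> 0 <= b -> 0 <= c -> 0 <= d -> a * d + b * c = D ->
  piercing (map block s) (lattice (a, b) (c, - d)) ->
  exists c' d' e f, piercing_superbase c' d' e f /\ superbase_det c' d' e f = D.
Proof.
move=> a0 b0 c0 d0 <- pL; have [db|/ltW bd] := leP d b.
- exists c, d, a, (b - d); split; last by rewrite /superbase_det; ring.
  by split; [rewrite subr_ge0|rewrite lattice_swap subrKC].
- exists a, b, c, (d - b); split; last by rewrite /superbase_det; ring.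
  split; first by rewrite subr_ge0.
  by have := piercing_reflect pL; rewrite /= opprK subrKC.
Qed.

(* Subtracting one of two comparable vectors from the other lowers the sum of
   the coordinates by at least [D / M]. *)
Lemma superbase_of_nonneg_basis (n : nat) M D a b c d :
  0 <= a <= M -> 0 <= b <= M -> 0 <= c <= M -> 0 <= d <= M ->
  `|a * d - b * c| = D -> M * (a + b + c + d) < n%:R * D ->
  piercing (map block s) (lattice (a, b) (c, d)) ->
  exists c' d' e f, piercing_superbase c' d' e f /\ superbase_det c' d' e f = D.
Proof.
elim: n a b c d => [|n IHn] a b c d a_itv b_itv c_itv d_itv detE.
  by rewrite mul0r => ?; nra.
rewrite -natr1 mulrDl mul1r => sum_lt pL.
have [a0 b0 c0 d0] : [/\ 0 <= a, 0 <= b, 0 <= c & 0 <= d] by split; lra.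
have D_le : D <= a * d + b * c.
  by rewrite -detE (le_trans (ler_normB _ _))// !ger0_norm ?mulr_ge0.
have [ca|/ltW ac] := leP c a; have [db|/ltW bd] := leP d b.
- apply: (IHn (a - c) (b - d) c d); try lra.
  + by rewrite -detE; congr `|_|; ring.
  + by nra.
  + by rewrite lattice_sub.
- apply: (@superbase_of_mixed_basis D c d (a - c) (d - b));
    rewrite ?subr_ge0 //.
    by rewrite -detE -[LHS]ger0_norm; [congr `|_|; ring|nra].
  by rewrite opprB lattice_swap lattice_sub.
- apply: (@superbase_of_mixed_basis D a b (c - a) (b - d));
    rewrite ?subr_ge0 //.
    by rewrite -detE -normrN -[LHS]ger0_norm; [congr `|_|; ring|nra].
  by rewrite opprB lattice_swap lattice_sub lattice_swap.
- apply: (IHn a b (c - a) (d - b)); try lra.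
  + by rewrite -detE; congr `|_|; ring.
  + by nra.
  + by rewrite lattice_swap lattice_sub lattice_swap.
Qed.

Lemma superbase_exists u v :
  0 < `|det2 u v| -> piercing (map block s) (lattice u v) ->
  exists c d e f,
    piercing_superbase c d e f /\ superbase_det c d e f = `|det2 u v|.
Proof.
wlog u1_ge0 : u / 0 <= u.1 => [wlog_u1|].
  have [|u1_lt0] := leP 0 u.1; first exact: wlog_u1.
  have <- : `|det2 (- u) v| = `|det2 u v|.
    by rewrite -[RHS]normrN /det2 /=; congr `|_|; ring.
  by rewrite -lattice_opp; apply: wlog_u1; rewrite /= oppr_ge0 ltW.
wlog v1_ge0 : v / 0 <= v.1 => [wlog_v1|].
  have [|v1_lt0] := leP 0 v.1; first exact: wlog_v1.
  have <- : `|det2 u (- v)| = `|det2 u v|.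
    by rewrite -[RHS]normrN /det2 /=; congr `|_|; ring.
  rewrite lattice_swap -lattice_opp lattice_swap.
  by apply: wlog_v1; rewrite /= oppr_ge0 ltW.
wlog u2_ge0 : u v u1_ge0 v1_ge0 / 0 <= u.2 => [wlog_u2|].
  have [|u2_lt0] := leP 0 u.2; first exact: wlog_u2.
  have <- : `|det2 (u.1, - u.2) (v.1, - v.2)| = `|det2 u v|.
    by rewrite -[RHS]normrN /det2 /=; congr `|_|; ring.
  move=> det_gt0 /piercing_reflect; apply: wlog_u2 => //=.
  by rewrite oppr_ge0 ltW.
case: u v => [a b] [c d] /= in u1_ge0 u2_ge0 v1_ge0 *.
rewrite /det2 /= => det_gt0 pL; have [d_ge0|d_lt0] := leP 0 d.
- pose M := a + b + c + d.
  pose n := (Num.truncn (M * M / `|a * d - b * c|)).+1.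
  apply: (@superbase_of_nonneg_basis n M _ a b c d) => //;
    try by rewrite /M; lra.
  by rewrite -ltr_pdivrMr// truncnS_gt.
- apply: (superbase_of_mixed_basis u1_ge0 u2_ge0 v1_ge0 (d := - d)).
  + by rewrite oppr_ge0 ltW.
  + by rewrite -normrN ger0_norm; [ring|nra].
  + by rewrite opprK.
Qed.

Lemma superbase_next_le c d e f :
  d <= f -> piercing_superbase c d e f ->
  piercing_superbase c d (c + e) (f - d).
Proof.
move=> df [[c0 d0 e0 f0] pL]; split; first by split; lra.
rewrite subrKC lattice_swap -lattice_sub lattice_swap.
by congr (piercing _ (lattice _ _)): pL; congr pair; ring.
Qed.

Lemma superbase_next_ge c d e f :
  f <= d -> piercing_superbase c d e f ->
  piercing_superbase (c + e) f c (d - f).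
Proof.
move=> fd [[c0 d0 e0 f0] /piercing_reflect pL]; split; first by split; lra.
rewrite subrKC -lattice_sub lattice_swap.
by congr (piercing _ (lattice _ _)): pL => /=; congr pair; ring.
Qed.

Lemma superbase_fits c d e f w h :
  piercing_superbase c d e f -> (w, h) \in s -> c + e <= w \/ d + d + f <= h.
Proof.
move=> [[c0 d0 e0 f0] pL] wh_s.
have [] := @piercing_fits _ s e (d + f) c d w h; rewrite ?addr_ge0 //.
- by rewrite lattice_swap.
- by rewrite addrC; left.
- by right; lra.
Qed.

Hypothesis s_sym : forall w h, (w, h) \in s -> (h, w) \in s.

Lemma superbase_transpose c d e f :
  piercing_superbase c d e f -> piercing_superbase d c f e.
Proof.
move=> [[c0 d0 e0 f0] pL]; split=> //.
rewrite -lattice_opp lattice_swap -lattice_sub lattice_swap.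
have /= := piercing_transpose s_sym pL.
by congr (piercing _ (lattice _ _)); congr pair => /=; ring.
Qed.

Lemma superbase_prev_le c d e f :
  c <= e -> piercing_superbase c d e f ->
  piercing_superbase c d (e - c) (d + f).
Proof.
by move=> ce /superbase_transpose /(superbase_next_le ce) /superbase_transpose.
Qed.

Lemma superbase_prev_ge c d e f :
  e <= c -> piercing_superbase c d e f ->
  piercing_superbase e (d + f) (c - e) d.
Proof.
by move=> ec /superbase_transpose /(superbase_next_ge ec) /superbase_transpose.
Qed.

Lemma superbase_fits_next c d e f w h :
  piercing_superbase c d e f -> (w, h) \in s ->
  c + c + e <= w \/ d + f <= h.
Proof.
move=> /superbase_transpose sb /s_sym hw_s.
by have [] := superbase_fits sb hw_s; [right|left].
Qed.

End Superbases.

Section Staircase.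
Variable R : realType.
Implicit Types (c d e f w h M : R).

Definition staircase : seq (R * R) :=
  [:: (6, 1); (4, 2); (3, 3); (2, 4); (1, 6)].

Lemma staircase_sym w h : (w, h) \in staircase -> (h, w) \in staircase.
Proof.
by rewrite !inE !xpair_eqE => /or4P[|||/orP[]] /andP[-> ->]; rewrite ?orbT.
Qed.

Definition below_staircase w h : Prop :=
  [/\ w <= 6 \/ h <= 1, w <= 4 \/ h <= 2, w <= 3 \/ h <= 3,
      w <= 2 \/ h <= 4 & w <= 1 \/ h <= 6].

Lemma superbase_below c d e f :
  piercing_superbase staircase c d e f -> below_staircase (c + e) (d + d + f).
Proof.
by move=> sb; split; apply: (superbase_fits sb); rewrite !inE eqxx ?orbT.
Qed.

Lemma superbase_below_next c d e f :
  piercing_superbase staircase c d e f -> below_staircase (c + c + e) (d + f).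
Proof.
by move=> sb; split; apply: (superbase_fits_next staircase_sym sb);
  rewrite !inE eqxx ?orbT.
Qed.

(* The empty rectangle of this superbase has width at most 3, and the next empty
   rectangle has height at most 3. *)
Definition crossing c d e f : Prop :=
  [/\ piercing_superbase staircase c d e f, c + e <= 3 & d + f <= 3].

Lemma crossing_transpose c d e f : crossing c d e f -> crossing d c f e.
Proof.
case=> sb width height; split=> //.
exact: (superbase_transpose staircase_sym).
Qed.

Lemma crossing_next_le_bounds c d e f : crossing c d e f -> d <= f ->
  5 < superbase_det c d e f -> d <= 1 /\ f <= 2.
Proof.
rewrite /superbase_det => -[sb width height] d_le_f det_gt5.
have [[c0 d0 e0 f0] _] := sb.
have sb_next := superbase_next_le d_le_f sb.
have d_le1 : d <= 1.
  have [f_le2d|?] := leP f (d + d); last by lra.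
  have fBd_le_d : f - d <= d by lra.
  have [[width_le6|?] _ _ _ _] :=
    superbase_below_next (superbase_next_ge fBd_le_d sb_next); last by lra.
  suff : c * d + c * f + e * d <= 3 * c + 3 / 2 * e by lra.
  nra.
split=> //.
have [_ [width_le4|?] _ _ _] := superbase_below_next sb_next; last by lra.
suff : c * d + c * f + e * d <= 3 * c + e by lra.
nra.
Qed.

Lemma crossing_det_le5_prev_le_next_le c d e f :
  crossing c d e f -> c <= e -> d <= f -> superbase_det c d e f <= 5.
Proof.
move=> cr c_le_e d_le_f; rewrite leNgt; apply/negP => det_gt5.
have [[[c0 d0 e0 f0] _] _ _] := cr.
have [d_le1 f_le2] := crossing_next_le_bounds cr d_le_f det_gt5.
have [|c_le1 e_le2] := crossing_next_le_bounds (crossing_transpose cr) c_le_e.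
  by rewrite superbase_det_transpose.
by move: det_gt5; rewrite /superbase_det; nra.
Qed.

Lemma crossing_det_le5_prev_ge_next_ge c d e f :
  crossing c d e f -> e <= c -> f <= d -> superbase_det c d e f <= 5.
Proof.
rewrite /superbase_det => -[sb width height] e_le_c f_le_d.
have [[c0 d0 e0 f0] _] := sb.
have [next61 next42 _ _ _] :=
  superbase_below_next (superbase_next_ge f_le_d sb).
have [_ _ _ prev24 prev16] :=
  superbase_below (superbase_prev_ge staircase_sym e_le_c sb).
have [d_le1|d_gt1] := leP d 1.
  have [c_le2|c_gt2] := leP c 2.
    suff : c * d + c * f + e * d <= c + c + e by lra.
    nra.
  have height_le4 : 3 * d + 2 * f <= 4 by case: prev24; lra.
  suff : c * d + c * f + e * d <= 3 * (d + f) by lra.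
  nra.
have [c_le1|c_gt1] := leP c 1.
  have [d_le2|d_gt2] := leP d 2.
    suff : c * d + c * f + e * d <= d + d + f by lra.
    nra.
  have width_le4 : 3 * c + 2 * e <= 4 by case: next42; lra.
  suff : c * d + c * f + e * d <= 3 * (c + e) by lra.
  nra.
have width_le6 : 3 * c + 2 * e <= 6 by case: next61; lra.
have height_le6 : 3 * d + 2 * f <= 6 by case: prev16; lra.
have det_le : c * d + c * f + e * d <= 3 * c + 3 * d - 2 * (c * d) by nra.
have [c_le2 d_le2] : c <= 2 /\ d <= 2 by lra.
nra.
Qed.

Lemma crossing_det_le5_prev_ge_next_le c d e f :
  crossing c d e f -> e <= c -> d <= f -> superbase_det c d e f <= 5.
Proof.
move=> cr e_le_c d_le_f; rewrite leNgt; apply/negP => det_gt5.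
have [sb width height] := cr; have [[c0 d0 e0 f0] _] := sb.
have [d_le1 f_le2] := crossing_next_le_bounds cr d_le_f det_gt5.
move: det_gt5; rewrite /superbase_det ltNge => /negP; apply.
have sb_prev := superbase_prev_ge staircase_sym e_le_c sb.
have [_ _ _ prev24 prev16] := superbase_below sb_prev.
have [_ self42 _ _ _] := superbase_below_next sb.
have [next61 _ _ _ _] := superbase_below_next (superbase_next_le d_le_f sb).
have [cBe_le1|height_le6] : c - e <= 1 \/ 4 * d + 3 * f <= 6.
- have [e_le_cBe|/ltW cBe_le_e] := leP e (c - e).
  + have [_ _ _ _ [?|?]] :=
      superbase_below (superbase_prev_le staircase_sym e_le_cBe sb_prev);
      [left|right]; lra.
  + have [_ _ _ _ [?|?]] :=
      superbase_below (superbase_prev_ge staircase_sym cBe_le_e sb_prev);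
      [left|right]; lra.
- have [width_le4|height_le2] := self42; last first.
    have c_le2 : c <= 2 by lra.
    suff : c * d + c * f + e * d <= 3 * d + 2 * f by lra.
    nra.
  have det_le : c * d + c * f + e * d <= 4 * d + c * (f - d) by nra.
  have [c_le1|c_gt1] := leP c 1; first by nra.
  have height_le6 : 3 * d + 2 * f <= 6 by case: prev16; lra.
  have c_le53 : c <= 5 / 3 by lra.
  nra.
- have [c_le2|c_gt2] := leP c 2.
    suff : c * d + c * f + e * d <= 3 * d + 2 * f by lra.
    nra.
  have f_le1 : f <= 1 by case: next61; lra.
  have height_le4 : 3 * d + 2 * f <= 4 by case: prev24; lra.
  suff : c * d + c * f + e * d <= 3 * (d + f) by lra.
  nra.
Qed.

Lemma crossing_det_le5 c d e f :
  crossing c d e f -> superbase_det c d e f <= 5.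
Proof.
move=> cr.
have [c_le_e|/ltW e_le_c] := leP c e; have [d_le_f|/ltW f_le_d] := leP d f.
- exact: crossing_det_le5_prev_le_next_le.
- rewrite -superbase_det_transpose.
  exact: crossing_det_le5_prev_ge_next_le (crossing_transpose cr) f_le_d c_le_e.
- exact: crossing_det_le5_prev_ge_next_le.
- exact: crossing_det_le5_prev_ge_next_ge.
Qed.

(* Passing to the next superbase widens the empty rectangle by [c] and lowers it
   by [d], so it lowers the left-hand side of the last hypothesis by
   [3 * d + M * c], which is at least the determinant. *)
Lemma superbase_det_le5_narrow (n : nat) M c d e f :
  piercing_superbase staircase c d e f -> c + e <= 3 -> d + f <= M ->
  3 * (d + d + f) + M * (3 - (c + e)) < n%:R * superbase_det c d e f ->
  superbase_det c d e f <= 5.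
Proof.
elim: n c d e f => [|n IHn] c d e f sb width height;
  have [[c0 d0 e0 f0] _] := sb.
  by rewrite mul0r => ?; nra.
rewrite -natr1 mulrDl mul1r => potential_lt.
have [_ _ [next_width|next_height] _ _] := superbase_below_next sb; last first.
  exact: crossing_det_le5.
have det_le : superbase_det c d e f <= 3 * d + M * c.
  by rewrite /superbase_det; nra.
have [d_le_f|/ltW f_le_d] := leP d f.
- rewrite -superbase_det_next_le; apply: IHn;
    rewrite ?superbase_det_next_le; first exact: superbase_next_le.
  1,2,3: lra.
- rewrite -superbase_det_next_ge; apply: IHn;
    rewrite ?superbase_det_next_ge; first exact: superbase_next_ge.
  1,2,3: lra.
Qed.

Lemma superbase_det_le5 c d e f :
  piercing_superbase staircase c d e f -> superbase_det c d e f <= 5.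
Proof.
move=> sb; wlog width : c d e f sb / c + e <= 3 => [wlog_width|].
  have [[c0 d0 e0 f0] _] := sb.
  have [_ _ [width|height] _ _] := superbase_below sb; first exact: wlog_width.
  rewrite -superbase_det_transpose; apply: wlog_width; last by lra.
  exact: (superbase_transpose staircase_sym).
rewrite leNgt; apply/negP => det_gt5.
have det_gt0 : 0 < superbase_det c d e f by lra.
pose potential := 3 * (d + d + f) + (d + f) * (3 - (c + e)).
pose n := (Num.truncn (potential / superbase_det c d e f)).+1.
suff : superbase_det c d e f <= 5 by lra.
apply: (@superbase_det_le5_narrow n (d + f)) => //.
by rewrite -ltr_pdivrMr// truncnS_gt.
Qed.

Lemma piercing_lattice_det_le5 (u v : R * R) : det2 u v != 0 ->
  piercing (map block staircase) (lattice u v) -> `|det2 u v| <= 5.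
Proof.
rewrite -normr_gt0 => det_gt0 /(superbase_exists det_gt0).
by move=> [c [d [e [f [sb <-]]]]]; exact: superbase_det_le5.
Qed.

Lemma pi_lat_staircase_ge : ((5^-1)%:E <= pi_lat (map block staircase))%E.
Proof.
apply: le_ereal_inf_tmp => _ [[u v] /= [det_neq0 pL] <-].
by rewrite lee_fin lef_pV2 ?posrE ?normr_gt0// piercing_lattice_det_le5.
Qed.

End Staircase.

Section Density.
Variable R : realType.
Implicit Types (P : set (R * R)) (D A r x y l : R).

Lemma esum1_le_size (T : choiceType) (A : set T) (s : seq T) :
  A `<=` [set` s] -> (\esum_(x in A) 1%E <= (size s)%:R%:E :> \bar R)%E.
Proof.
move=> As; apply: ge_ereal_sup => _ [X [finX XA] <-].
rewrite fsbig_finite//= sumEFin lee_fin big_const_seq count_predT iter_addr_0.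
rewrite ler_nat; apply: uniq_leq_size => [|x]; first exact: fset_uniq.
by rewrite in_fset_set// => /set_mem /XA /As.
Qed.

Lemma density_le P D A : 0 <= D -> 0 <= A ->
  (forall r, 0 <= r -> (count_in P r <= (D * (2 * r + A) ^+ 2)%:E)%E) ->
  (density P <= D%:E)%E.
Proof.
move=> D0 A0 countP; apply/lee_addgt0Pr => eps eps_gt0; rewrite -EFinD.
pose r0 := 1 + A + 2 * D * A / eps.
pose ratio r := (count_in P r * ((2 * r) ^+ 2)^-1%:E)%E.
apply: ge_ereal_inf; exists (ereal_sup [set ratio r | r in [set r | r0 < r]]).
  by exists [set r | r0 < r] => //; apply: nbhs_pinfty_gt; exact: num_real.
apply: ge_ereal_sup => _ [r /= r0_lt <-]; rewrite /r0 in r0_lt.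
have ? : 0 <= 2 * D * A / eps by rewrite divr_ge0 ?mulr_ge0// ltW.
have r_ge1 : 1 <= r by lra.
have A_le : A <= r by lra.
have DA_le : 2 * D * A <= eps * r.
  by rewrite [leRHS]mulrC -ler_pdivrMr//; lra.
have r_ge0 : 0 <= r by lra.
apply: le_trans (lee_wpmul2r _ (countP r r_ge0)) _.
  by rewrite lee_fin invr_ge0 exprn_ge0//; lra.
rewrite -EFinM lee_fin ler_pdivrMr ?exprn_gt0//; last by lra.
have : D * A * A <= D * A * r by rewrite ler_wpM2l ?mulr_ge0.
have : 2 * D * A * r <= eps * r * r by rewrite ler_wpM2r.
rewrite !expr2; nra.
Qed.

End Density.

Section PeriodicSets.
Variables (R : realType) (n : nat) (X : seq (nat * nat)).
Implicit Types (r x y l : R).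

Definition periodic_set : set (R * R) :=
  [set p | exists (x : nat * nat) (i j : int),
     x \in X /\ p = (n%:R * i%:~R + x.1%:R, n%:R * j%:~R + x.2%:R)].

Definition itv_ints y l : seq int :=
  [seq Num.ceil y + k%:Z | k <- iota 0 (Num.truncn l).+1].

Lemma mem_itv_ints y l (i : int) : y <= i%:~R <= y + l -> i \in itv_ints y l.
Proof.
move=> /andP[yi iyl].
have ceil_le : Num.ceil y <= i by rewrite ceil_le_int.
apply/mapP; exists `|i - Num.ceil y|%N; last by lia.
rewrite mem_iota /= add0n ltnS truncn_ge_nat; last by lra.
rewrite natr_absz ger0_norm ?subr_ge0// intrB.
by have := ceil_ge y; lra.
Qed.

Hypothesis n_gt0 : (0 < n)%N.

Lemma count_periodic_set r : 0 <= r ->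
  (count_in periodic_set r <=
   ((size X)%:R / n%:R ^+ 2 * (2 * r + n%:R) ^+ 2)%:E)%E.
Proof.
move=> r_ge0; have nR_gt0 : 0 < n%:R :> R by rewrite ltr0n.
pose coefs a := itv_ints ((- r - a%:R) / n%:R) (2 * r / n%:R).
have coefsP (a : nat) (i : int) : `|n%:R * i%:~R + a%:R| <= r -> i \in coefs a.
  rewrite ler_norml => ?; apply: mem_itv_ints.
  by rewrite -mulrDl ler_pdivrMr// ler_pdivlMr//; lra.
pose s := [seq (n%:R * ij.1%:~R + x.1%:R, n%:R * ij.2%:~R + x.2%:R) : R * R |
  x : nat * nat <- X,
  ij : int * int <- [seq (i, j) | i <- coefs x.1, j <- coefs x.2]].
pose k := (Num.truncn (2 * r / n%:R)).+1.
have size_s : size s = (size X * (k * k))%N.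
  rewrite size_allpairs_dep sumnE big_map (eq_bigr (fun=> (k * k)%N)).
    by rewrite big_const_seq count_predT iter_addn_0 mulnC.
  by move=> x _; rewrite size_allpairs !size_map size_iota.
apply: (@le_trans _ _ (size s)%:R%:E).
  apply: esum1_le_size => p [[x [i [j [xX ->]]]] [/= /coefsP ri /coefsP rj]].
  apply/allpairsPdep; exists x, (i, j); split=> //.
  by apply/allpairsP; exists (i, j).
have k_le : k%:R <= (2 * r + n%:R) / n%:R.
  by rewrite -[k%:R]natr1 [leRHS]mulrDl mulfV ?lt0r_neq0//
    lerD2r truncn_le// divr_ge0 ?mulr_ge0.
rewrite lee_fin size_s !natrM mulrAC -mulrA -expr_div_n expr2.
by rewrite ler_wpM2l// ler_pM.
Qed.

Lemma density_periodic_set :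
  (density periodic_set <= ((size X)%:R / n%:R ^+ 2)%:E)%E.
Proof.
apply: density_le count_periodic_set; last exact: ler0n.
by rewrite divr_ge0 ?exprn_ge0.
Qed.

Lemma ceil_residue x : exists (q : int) (k : nat),
  (k < n)%N /\ x <= n%:R * q%:~R + k%:R < x + 1.
Proof.
have n_gt0Z : (0 < n%:Z)%R by [].
have mod_ge0 : (0 <= Num.ceil x %% n)%Z by rewrite modz_ge0// gt_eqF.
have mod_lt : (Num.ceil x %% n < n)%Z by rewrite ltz_pmod.
exists (Num.ceil x %/ n)%Z, `|(Num.ceil x %% n)%Z|%N; split; first by lia.
rewrite natr_absz ger0_norm// pmulrn mulrC -intrM -intrD -divz_eq.
by have := ceil_itv x; rewrite intrB; lra.
Qed.

Definition residue_block (a b w h : nat) : seq (nat * nat) :=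
  [seq ((a + i) %% n, (b + j) %% n)%N | i <- iota 0 w, j <- iota 0 h].

Lemma periodic_set_meets_blocks w h :
  all2rel (fun a b => has (mem X) (residue_block a b w h)) (iota 0 n) ->
  meets_blocks periodic_set w%:R h%:R.
Proof.
move=> /allrelP X_meets x y.
have [q [a [a_lt qa_itv]]] := ceil_residue x.
have [q' [b [b_lt q'b_itv]]] := ceil_residue y.
have /hasP[_ /allpairsP[[i j] /= [+ + ->]] ij_X] :
  has (mem X) (residue_block a b w h) by apply: X_meets; rewrite mem_iota.
rewrite !mem_iota !add0n /= -!(ler_nat R) -!natr1 => i_lt j_lt.
have i_ge0 : 0 <= i%:R :> R by [].
have j_ge0 : 0 <= j%:R :> R by [].
exists (n%:R * q%:~R + a%:R + i%:R, n%:R * q'%:~R + b%:R + j%:R).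
split=> [|/=|/=]; [|lra..].
exists ((a + i) %% n, (b + j) %% n)%N.
exists (q + ((a + i) %/ n)%N), (q' + ((b + j) %/ n)%N).
have divE k m : k%:R + m%:R = ((k + m) %/ n)%:R * n%:R + ((k + m) %% n)%:R :> R.
  by rewrite -natrM -!natrD -divn_eq.
split=> //; rewrite -!addrA !divE.
by congr pair; rewrite /= intrD -pmulrn; ring.
Qed.

End PeriodicSets.

Definition torus_permutation : seq (nat * nat) :=
  [:: (0, 0); (1, 2); (2, 4); (3, 1); (4, 5); (5, 3)]%N.

Lemma piercing_torus_permutation (R : realType) :
  piercing (map block (staircase R)) (periodic_set 6 torus_permutation).
Proof.
apply/piercing_blocksP => w h; rewrite !inE !xpair_eqE.
case/or4P => [|||/orP[]] /andP[/eqP -> /eqP ->].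
- exact: (@periodic_set_meets_blocks R 6 _ isT 6 1).
- exact: (@periodic_set_meets_blocks R 6 _ isT 4 2).
- exact: (@periodic_set_meets_blocks R 6 _ isT 3 3).
- exact: (@periodic_set_meets_blocks R 6 _ isT 2 4).
- exact: (@periodic_set_meets_blocks R 6 _ isT 1 6).
Qed.

Lemma pi_dens_staircase_le (R : realType) :
  (pi_dens (map block (staircase R)) <= (6^-1)%:E)%E.
Proof.
apply: ge_ereal_inf; exists (density (@periodic_set R 6 torus_permutation)).
  by eexists; first exact: piercing_torus_permutation.
apply: le_trans (density_periodic_set _ _ _) _ => //.
by rewrite lee_fin /=; lra.
Qed.

Theorem theorem6 (R : realType) :
  exists F : seq (R * R * R * R),
    size F = 5%N /\ uniq F /\ (forall q, q \in F -> proper_rect q) /\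
    ((6 / 5 : R)%:E * pi_dens F <= pi_lat F)%E.
Proof.
exists (map block (staircase R)); split=> //; split; last split.
- by rewrite /= !inE !xpair_eqE !(eqr_nat, pnatr_eq1) /= ?andbF.
- move=> _ /mapP[wh + ->].
  by rewrite !inE => /or4P[|||/orP[]] /eqP ->; split=> /=; lra.
- apply: le_trans (pi_lat_staircase_ge R).
  have -> : (5^-1)%:E = ((6 / 5)%:E * (6^-1)%:E)%E :> \bar R.
    by rewrite -EFinM; congr EFin; lra.
  by rewrite lee_pmul2l// pi_dens_staircase_le.
Qed.
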